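(* Let $p$ be an odd prime and $n\ge2$ an integer with base-$p$ expansion $n=n_0+n_1p+\cdots+n_kp^k$, $n_j\in\{0,\ldots,p-1\}$, $n_k>0$. Define \[ P:=\{b_0+b_1p+\cdots+b_kp^k: 0\le b_j\le n_j,\ j=0,\ldots,k\}\setminus\{n\}, \] a subset of $\{0,1,\ldots,n-1\}$ with $|P|=\prod_{j=0}^k(n_j+1)-1$. For a pseudo-composition $\beta=(\beta_1,\ldots,\beta_\ell)$ of $n$ write $\beta_i=\sum_{j=0}^k\beta_{ij}p^j$ with digits $\beta_{ij}\in\{0,\ldots,p-1\}$. For $T\subseteq P$ define \[ r^B(T):=\sum_{\substack{\beta\models_0 n,\ D(\beta)\subseteq T\\ \beta_{1j}+\cdots+\beta_{\ell j}=n_j\ \forall j}}(-1)^{|T|-|D(\beta)|}\prod_{j=0}^k 2^{\,n_j-\beta_{1j}}\binom{n_j}{\beta_{1j},\ldots,\beta_{\ell j}}. \] Then for every $i\in\mathbb{Z}_p$, \[ c^B_{p,i}(n)=\begin{cases} 2^{\,n+1-\prod_{j}(n_j+1)}\,|\{T\subseteq P: r^B(T)\equiv i\pmod p\}| & \text{if } i=0 \text{ or } n_0=\cdots=n_{k-1}=p-1,\\ 2^{\,n-\prod_j(n_j+1)}\,|\{T\subseteq P: r^B(T)\equiv i\text{ or } r^B(T)\equiv -i\pmod p\}| & \text{otherwise.}\end{cases} \]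
   Context: A signed permutation of $[n]$ is a bijection $w$ of $\{\pm1,\ldots,\pm n\}$ with $w(-i)=-w(i)$; these form $\mathfrak{S}^B_n$. With $w(0):=0$, $D(w)=\{i\in\{0,\ldots,n-1\}: w(i)>w(i+1)\}$. A pseudo-composition of $n$ ($\alpha\models_0 n$) is a sequence $(\alpha_1,\ldots,\alpha_\ell)$ of integers with $\alpha_1\ge0$, $\alpha_2,\ldots,\alpha_\ell>0$ and sum $n$, with $D(\alpha)=\{\alpha_1,\alpha_1+\alpha_2,\ldots,\alpha_1+\cdots+\alpha_{\ell-1}\}\subseteq\{0,\ldots,n-1\}$. The type $B$ ribbon number is $r^B_\alpha=|\{w\in\mathfrak{S}^B_n: D(w)=D(\alpha)\}|$ and $c^B_{p,i}(n)=|\{\alpha\models_0 n: r^B_\alpha\equiv i\pmod p\}|$. Multinomial coefficients $\binom{m}{m_1,\ldots,m_k}$ equal $m!/(m_1!\cdots m_k!)$ if $\sum m_i=m$ and $0$ otherwise. *)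

(* Defs.v *)
From mathcomp Require Import all_boot all_order all_fingroup all_algebra.
Set Implicit Arguments. Unset Strict Implicit. Unset Printing Implicit Defensive.
Import GRing.Theory Num.Theory.

(* The set {+-1,...,+-n} is encoded as 'I_n * bool:
   (k, false) stands for k+1 and (k, true) stands for -(k+1). *)
Definition sval_of (n : nat) (x : 'I_n * bool) : int :=
  if x.2 then (- Posz x.1.+1)%R else Posz x.1.+1.

Definition sneg (n : nat) (x : 'I_n * bool) : 'I_n * bool := (x.1, ~~ x.2).

Definition is_signed_perm (n : nat) (w : {perm ('I_n * bool)}) : bool :=
  [forall x, w (sneg x) == sneg (w x)].

Definition wat (n : nat) (w : {perm ('I_n * bool)}) (j : nat) : int :=
  if j is j'.+1 then
    (if insub j' is Some o then sval_of (w (o, false)) else 0%R)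
  else 0%R.

Definition sdes (n : nat) (w : {perm ('I_n * bool)}) : {set 'I_n} :=
  [set i : 'I_n | (wat w i.+1 < wat w i)%R].

Definition is_pcomp (n : nat) (a : seq nat) : bool :=
  [&& size a != 0, all (fun x => 0 < x) (behead a) & sumn a == n].

Definition psums (a : seq nat) : seq nat :=
  [seq sumn (take j a) | j <- iota 1 (size a).-1].

Definition pdes (n : nat) (a : seq nat) : {set 'I_n} :=
  [set i : 'I_n | val i \in psums a].

(* The list of all pseudo-compositions of n (each exactly once): a
   pseudo-composition of n has length at most n+1 and entries at most n. *)
Definition pcomps (n : nat) : seq (seq nat) :=
  flatten [seq [seq s <- [seq map val (tval t) | t <- enum {: l.-tuple 'I_n.+1}]
               | is_pcomp n s] | l <- iota 0 n.+2].

Definition ribbonB (n : nat) (a : seq nat) : nat :=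
  #|[set w : {perm ('I_n * bool)} | is_signed_perm w && (sdes w == pdes n a)]|.

Definition cB (p i n : nat) : nat :=
  count (fun a => ribbonB n a %% p == i) (pcomps n).

Definition digit (p m j : nat) : nat := (m %/ p ^ j) %% p.

Definition topk (p n : nat) : nat := trunc_log p n.

Definition multinom (m : nat) (s : seq nat) : nat :=
  if sumn s == m then m`! %/ \prod_(x <- s) x`! else 0.

Definition Pset (p n : nat) : {set 'I_n} :=
  [set m : 'I_n | [exists b : {ffun 'I_(topk p n).+1 -> 'I_p},
      [forall j, val (b j) <= digit p n j] &&
      (val m == \sum_(j < (topk p n).+1) val (b j) * p ^ j)]].

Definition rB (p n : nat) (T : {set 'I_n}) : int :=
  (\sum_(b <- pcomps n |
        (pdes n b \subset T) &&
        [forall j : 'I_(topk p n).+1,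
           sumn [seq digit p x j | x <- b] == digit p n j])
     ((-1) ^+ (#|T| - #|pdes n b|) * Posz
      (\prod_(j < (topk p n).+1)
          (2 ^ (digit p n j - digit p (head 0 b) j) *
           multinom (digit p n j) [seq digit p x j | x <- b]))%N))%R.

(* Main.v *)
(* Let a(S) be the number of signed permutations whose descent set is contained in S, and write
   S = D(beta). Sorting each block of positions turns such a signed permutation into a word that
   records, for every absolute value, its block and its sign; hence
   a(S) = 2^(n - beta_1) n! / prod beta_i!. By the theorems of Lucas and Fermat this is modulo p the
   product over the base-p digits appearing in r^B(T), and it vanishes unless S is contained in P.
   Moebius inversion over the Boolean lattice then gives r^B_T = r^B(T) for every T, and
   r^B_S = (-1)^|S \ P| r^B(S :&: P), modulo p. If P is everything this is the claim; otherwise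
   toggling a point outside P pairs the S with r^B_S = i with those with r^B_S = - i. *)
Require Import Defs.
From mathcomp Require Import all_boot all_order all_fingroup all_algebra.
From mathcomp Require Import zify.
Set Implicit Arguments. Unset Strict Implicit. Unset Printing Implicit Defensive.
Import Order.TTheory GRing.Theory Num.Theory.

(** * Multinomial coefficients modulo a prime *)

Lemma dvdn_prod_fact (s : seq nat) : \prod_(x <- s) x`! %| (sumn s)`!.
Proof.
elim: s => [|b s IH]; first by rewrite big_nil.
rewrite big_cons /= -(@bin_fact (b + sumn s) b) ?leq_addr // addKn.
exact/dvdn_mull/dvdn_mul.
Qed.

Lemma multinom_fact (s : seq nat) :
  multinom (sumn s) s * \prod_(x <- s) x`! = (sumn s)`!.
Proof. by rewrite /multinom eqxx divnK // dvdn_prod_fact. Qed.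

Lemma prod_fact_gt0 (s : seq nat) : 0 < \prod_(x <- s) x`!.
Proof. by apply: prodn_cond_gt0 => x _; apply: fact_gt0. Qed.

(** Reduces multinomials to binomials one entry at a time. For [b > n] the truncated [n - b] does no
    harm, as both sides are 0. *)
Lemma multinom_cons (n b : nat) (s : seq nat) :
  multinom n (b :: s) = 'C(n, b) * multinom (n - b) s.
Proof.
case: (leqP b n) => [le_bn | lt_nb]; last first.
  by rewrite bin_small // /multinom /= ifN // neq_ltn; apply/orP; right; lia.
have [E|N] := eqVneq (sumn s) (n - b); last first.
  rewrite /multinom /= (negbTE N) muln0 ifN //.
  by apply: contraNneq N => /= <-; rewrite addKn.
have En : n = sumn (b :: s) by rewrite /= E subnKC.
apply/eqP; rewrite -(eqn_pmul2r (prod_fact_gt0 (b :: s))) {1}En multinom_fact.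
rewrite big_cons -En mulnA (mulnAC 'C(n, b)) -mulnA -E multinom_fact E.
by rewrite -(bin_fact le_bn) mulnA.
Qed.

(** Induction on [n] by Pascal's rule, following the last digits as 1 is added. *)
Lemma lucas (p n m : nat) : prime p ->
  'C(n, m) = 'C(n %% p, m %% p) * 'C(n %/ p, m %/ p) %[mod p].
Proof.
move=> pr; have p_gt1 := prime_gt1 pr; have p_gt0 := prime_gt0 pr.
elim: n m => [|n IH] [|m]; rewrite ?mod0n ?div0n ?bin0 //.
  rewrite !bin0n.
  have [Dm|Nm] := boolP (p %| m.+1).
    have : 0 < m.+1 %/ p by rewrite divn_gt0 // dvdn_leq.
    by rewrite lt0n => /negbTE->; rewrite muln0 mod0n.
  by move: Nm; rewrite /dvdn => /negbTE->; rewrite mul0n mod0n.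
(* Adding 1 raises the last digit, or resets it to 0 and carries when it is [p.-1]. *)
have succ x : (x.+1 %% p = if x %% p == p.-1 then 0 else (x %% p).+1) *
              (x.+1 %/ p = if x %% p == p.-1 then (x %/ p).+1 else x %/ p).
  have lt := ltn_pmod x p_gt0.
  have e : x.+1 = x %/ p * p + (x %% p).+1 by rewrite addnS -divn_eq.
  case: eqP => E; rewrite e ?E ?prednK //; last first.
    have lt2 : (x %% p).+1 < p by lia.
    by rewrite modnMDl divnMDl // (modn_small lt2) (divn_small lt2) addn0.
  by rewrite -mulSnr modnMl mulnK.
rewrite binS -modnDm IH IH modnDm !succ.
have ltn := ltn_pmod n p_gt0; have ltm := ltn_pmod m p_gt0.
case: (eqVneq (n %% p)) => [En|Nn]; case: (eqVneq (m %% p)) => [Em|Nm].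
- by rewrite En Em binn !bin0 binS !mul1n.
(* Only [n] carries: Pascal's rule collects a binomial ['C(p, r)] with [0 < r < p], divisible by
   [p]. *)
- rewrite En -mulnDl bin0n mul0n mod0n -binS prednK //.
  apply/eqP; rewrite -/(dvdn _ _) dvdn_mulr // prime_dvd_bin //; lia.
- have lt2 : n %% p < m %% p by lia.
  by rewrite (bin_small lt2) !bin0 mul0n addn0.
- by rewrite binS mulnDl.
Qed.

(** By Fermat [(a ^ m) ^ p] is [a ^ m], so powers of 2 split into quotient and last digit just as
    multinomials do. *)
Lemma expn_modp (p a m r : nat) : prime p -> a ^ (m * p + r) = a ^ m * a ^ r %[mod p].
Proof. by move=> pr; rewrite expnD expnM -modnMml fermat_little // modnMml. Qed.

Lemma subn_divmod (p n b : nat) : b %% p <= n %% p -> b %/ p <= n %/ p ->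
  n - b = (n %/ p - b %/ p) * p + (n %% p - b %% p).
Proof.
move=> le0 le1; have le2 := leq_mul le1 (leqnn p).
rewrite {1}(divn_eq n p) {1}(divn_eq b p) mulnBl.
move: (n %/ p * p) (b %/ p * p) (n %% p) (b %% p) le0 le2; lia.
Qed.

(* The number of signed words with content [s], letters of the first block being positive. *)
Definition multinomB (n : nat) (s : seq nat) : nat :=
  2 ^ (n - head 0 s) * multinom n s.

(** Lucas entry by entry. If the last digit or the quotient of an entry exceeds that of [n], both
    sides vanish modulo [p]; otherwise subtracting the entry borrows nothing and the induction
    continues. *)
Lemma multinom_modp (p n : nat) (s : seq nat) : prime p ->
  multinom n s = multinom (n %% p) [seq x %% p | x <- s] *
                 multinom (n %/ p) [seq x %/ p | x <- s] %[mod p].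
Proof.
move=> pr; elim: s n => [|b s IH] n /=.
  (* [multinom n [::]] is the indicator of [n = 0], and a nonzero [n] has a nonzero last digit or
     quotient. *)
  rewrite /multinom /= big_nil !divn1.
  have [->|n0] := posnP n; first by rewrite mod0n div0n.
  rewrite -(eq_sym n) (gtn_eqF n0) mod0n.
  have [D|ND] := boolP (p %| n).
    by rewrite [0 == n %/ p]ltn_eqF ?muln0 ?mod0n // divn_gt0 ?prime_gt0 // dvdn_leq.
  by rewrite ifN ?mul0n ?mod0n // eq_sym.
rewrite !multinom_cons -modnMml lucas // modnMml -modnMmr IH modnMmr.
have [le0|lt0] := leqP (b %% p) (n %% p); last by rewrite (bin_small lt0) !mul0n.
have [le1|lt1] := leqP (b %/ p) (n %/ p); last first.
  by rewrite (bin_small lt1) muln0 !mul0n muln0.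
have p_gt0 := prime_gt0 pr; have ltr := ltn_pmod n p_gt0.
have E := subn_divmod le0 le1.
have lt2 : n %% p - b %% p < p by lia.
rewrite E modnMDl divnMDl // (modn_small lt2) (divn_small lt2) addn0.
by rewrite mulnACA.
Qed.

Lemma multinomB_modp (p n : nat) (s : seq nat) : prime p ->
  multinomB n s = multinomB (n %% p) [seq x %% p | x <- s] *
                  multinomB (n %/ p) [seq x %/ p | x <- s] %[mod p].
Proof.
move=> pr; rewrite /multinomB -modnMmr multinom_modp // modnMmr mulnACA.
case: s => [|b s] /=.
  by rewrite !subn0 -modnMml {1}(divn_eq n p) expn_modp // modnMml (mulnC (2 ^ _)).
rewrite !multinom_cons.
have [le0|lt0] := leqP (b %% p) (n %% p); last by rewrite (bin_small lt0) !(mul0n, muln0).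
have [le1|lt1] := leqP (b %/ p) (n %/ p); last by rewrite (bin_small lt1) !(mul0n, muln0).
have E := subn_divmod le0 le1.
by rewrite E -modnMml expn_modp // modnMml (mulnC (2 ^ _)).
Qed.

(** The bound on the entries ensures that [k] digits exhaust them too: at [k = 0] every entry is
    0. *)
Lemma multinomB_digits (p k n : nat) (s : seq nat) : prime p ->
  n < p ^ k -> all (fun x => x <= n) s ->
  multinomB n s = \prod_(j < k) multinomB (digit p n j) [seq digit p x j | x <- s]
    %[mod p].
Proof.
move=> pr; have p_gt0 := prime_gt0 pr.
elim: k n s => [|k IH] n s ltn alls.
  have n0 : n = 0 by move: ltn; rewrite expn0; case: (n).
  rewrite big_ord0 n0 /multinomB sub0n /multinom.
  have s0 : all (pred1 0) s by apply: sub_all alls => x; rewrite n0 leqn0.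
  have /all_pred1P -> := s0.
  by rewrite sumn_nseq mul0n eqxx big_nseq iter_muln_1 exp1n.
rewrite multinomB_modp // -modnMmr (IH (n %/ p)) ?ltn_divLR -?expnSr //; last first.
  by rewrite all_map; apply: sub_all alls => x /= le; apply: leq_div2r.
rewrite modnMmr big_ord_recl /digit expn0 divn1; congr ((_ * _) %% _).
  by congr multinomB; apply: eq_map => x; rewrite divn1.
apply: eq_bigr => j _ ; rewrite -map_comp lift0 expnS -divnMA.
by congr multinomB; apply: eq_map => x /=; rewrite -divnMA.
Qed.

(** * Words with given content *)

(** In the application a letter is a block with a sign, and [pr] forgets the sign. *)
Definition has_content (I : finType) (J : eqType) (pr : J -> I) (c : I -> nat) (s : seq J) :=
  [forall i, count (fun x => pr x == i) s == c i].

Lemma sum_tuple_cons (J : finType) (n : nat) (F : n.+1.-tuple J -> nat) :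
  \sum_t F t = \sum_(x : J) \sum_(t : n.-tuple J) F [tuple of x :: t].
Proof.
rewrite pair_bigA /= (reindex (fun xt : J * n.-tuple J => [tuple of xt.1 :: xt.2])) //.
exists (fun t => (thead t, [tuple of behead t])) => [[x t] _|t _] /=.
  by rewrite theadE; congr pair; apply: val_inj.
by rewrite -tuple_eta.
Qed.

(** A multinomial count of class patterns times the choices of letters, with denominators cleared;
    by induction on the first letter. *)
Lemma card_words (I J : finType) (pr : J -> I) (A : pred J) (n : nat) (c : I -> nat) :
  \sum_i c i = n ->
  #|[set t : n.-tuple J | all A t && has_content pr c t]| * \prod_i (c i)`! =
  n`! * \prod_i #|[set x | A x & pr x == i]| ^ c i.
Proof.
elim: n c => [|n IH] c sum_c.
  have c0 i : c i = 0 by apply/eqP; move/eqP: sum_c; rewrite sum_nat_eq0 => /forallP/(_ i).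
  rewrite !big1 ?muln1 => [|i _|i _]; rewrite ?c0 ?expn0 //.
  rewrite (_ : [set _ | _] = setT) ?cardsT ?card_tuple //.
  apply/setP => t; rewrite !inE tuple0 /=.
  by apply/forallP => i /=; rewrite c0.
rewrite -sum1dep_card big_mkcond sum_tuple_cons big_distrl /=.
pose wt i := #|[set x | A x & pr x == i]|.
(* Words starting with [x]: deleting [x] lowers the count of its class by 1. The factor [wt (pr x)]
   restores the power lost thereby and cancels once the letters of a class are summed. *)
have step x : A x -> (\sum_(t : n.-tuple J)
     (if A x && all A t && has_content pr c (x :: t) then 1 else 0)) * \prod_i (c i)`! * wt (pr x)
   = c (pr x) * (n`! * \prod_i wt i ^ c i).
  move=> Ax.
  have [c0|c_gt0] := posnP (c (pr x)).
    rewrite c0 mul0n big1 ?mul0n // => t _.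
    case: ifP => // /andP[_ /forallP/(_ (pr x))] /=.
    by rewrite eqxx c0.
  pose c' i := c i - (pr x == i).
  have c'E i : c i = (pr x == i) + c' i by rewrite subnKC //; case: eqP => // <-.
  have sum_c' : \sum_i c' i = n.
    move: sum_c; rewrite (eq_bigr _ (fun i _ => c'E i)) big_split /=.
    rewrite (bigD1 (pr x)) //= eqxx big1 => [|i]; first by rewrite addn0 => -[].
    by rewrite eq_sym => /negbTE->.
  have -> : \prod_i (c i)`! = c (pr x) * \prod_i (c' i)`!.
    rewrite (bigD1 (pr x)) //= [in RHS](bigD1 (pr x)) //= mulnA.
    congr (_ * _); first by rewrite {1 2}c'E /c' eqxx /= factS.
    by apply: eq_bigr => i /negbTE ne; rewrite /c' eq_sym ne subn0.
  have -> : \prod_i wt i ^ c i = wt (pr x) * \prod_i wt i ^ c' i.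
    rewrite (bigD1 (pr x)) //= [in RHS](bigD1 (pr x)) //= mulnA.
    congr (_ * _); first by rewrite {1}c'E eqxx /= expnS.
    by apply: eq_bigr => i /negbTE ne; rewrite /c' eq_sym ne subn0.
  have -> : \sum_(t : n.-tuple J)
     (if A x && all A t && has_content pr c (x :: t) then 1 else 0) =
     #|[set t : n.-tuple J | all A t && has_content pr c' t]|.
    rewrite -sum1dep_card [RHS]big_mkcond; apply: eq_bigr => t _.
    rewrite Ax /=; congr (if _ && _ then _ else _).
    by apply: eq_forallb => i /=; rewrite c'E eqn_add2l.
  rewrite [_ * (c _ * _)]mulnCA IH // -!mulnA; congr (_ * (_ * _)).
  by rewrite mulnC.
have wt_gt0 x : A x -> 0 < wt (pr x).
  by move=> Ax; apply/card_gt0P; exists x; rewrite inE Ax eqxx.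
apply/eqP; rewrite factS -sum_c.
rewrite (bigID A) /= [X in _ + X]big1 ?addn0 => [|x /negbTE nA]; last first.
  by rewrite big1 ?mul0n // => t _; rewrite nA.
rewrite (partition_big pr xpredT) //=.
rewrite -mulnA big_distrl /=; apply/eqP; apply: eq_bigr => i _.
have [w0|w_gt0] := posnP (wt i).
  rewrite big1 => [|x /andP[Ax /eqP Ei]]; last by have := wt_gt0 x Ax; rewrite Ei w0.
  have [->//|ci] := posnP (c i).
  by rewrite (bigD1 i) //= -/(wt i) w0 exp0n // mul0n !muln0.
apply/eqP; rewrite -(eqn_pmul2r w_gt0) big_distrl /=; apply/eqP.
rewrite (eq_bigr (fun=> c i * (n`! * \prod_i wt i ^ c i))) => [|x /andP[Ax /eqP <-]];
  last exact: step.
rewrite sum_nat_const mulnC; congr (_ * _).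
by apply: eq_card => x; rewrite !inE.
Qed.

(** * Positions and blocks *)

Lemma leq_sumn_take (b : seq nat) (i j : nat) : i <= j -> sumn (take i b) <= sumn (take j b).
Proof.
move=> le_ij; have [lt|ge] := ltnP j (size b).
  by rewrite -(subnKC le_ij) takeD sumn_cat leq_addr.
rewrite (take_oversize ge) -{2}(cat_take_drop i b) sumn_cat leq_addr //.
Qed.

Lemma sumn_takeS (b : seq nat) (i : nat) :
  sumn (take i.+1 b) = sumn (take i b) + nth 0 b i.
Proof.
have [lt|ge] := ltnP i (size b); first by rewrite (take_nth 0) // sumn_rcons.
by rewrite !take_oversize ?nth_default ?addn0 // leqW.
Qed.

Lemma card_ord_lt (n m : nat) : m <= n -> #|[set q : 'I_n | q < m]| = m.
Proof.
move=> le; have inj : injective (widen_ord le).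
  by move=> x y /(congr1 val) /= /val_inj.
rewrite -[RHS]card_ord -(card_imset predT inj); apply: eq_card => q.
rewrite inE; apply/idP/imsetP => [lt|[x _ ->]]; last exact: (ltn_ord x).
by exists (Ordinal lt) => //; apply: val_inj.
Qed.

Section Blocks.
Variables (n : nat) (b : seq nat).
Hypothesis comp_b : is_pcomp n b.

Lemma sumn_pcomp : sumn b = n. Proof. by case/and3P: comp_b => _ _ /eqP. Qed.

Lemma size_pcomp : 0 < size b <= n.+1.
Proof.
case/and3P: comp_b; case: (b) => //= x s _ pos /eqP <-; rewrite ltnS.
elim: s pos => //= y s IH /andP[y0 /IH]; lia.
Qed.

Lemma sumn_take_pcomp i : sumn (take i b) <= n.
Proof. by rewrite -sumn_pcomp -{2}(cat_take_drop i b) sumn_cat leq_addr. Qed.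

(* The index of the block of [b] which contains the position [q], both counted from [0]. *)
Definition bidx (q : nat) : nat := count (fun s => s <= q) (psums b).

(** The partial sums increase, so counting the boundaries up to [q] amounts to comparing [q] with a
    single partial sum. *)
Lemma bidx_leq q i : q < n -> (bidx q <= i) = (q < sumn (take i.+1 b)).
Proof.
move=> lt_qn; have /andP[sz_gt0 _] := size_pcomp.
rewrite /bidx /psums count_map.
(* [psums] omits the total [n], so from the last block on the bound is [n] itself. *)
have [lt_i|ge_i] := ltnP i (size b).-1; last first.
  rewrite take_oversize ?sumn_pcomp ?lt_qn; last by lia.
  by apply: leq_trans (count_size _ _) _; rewrite size_iota.
have [lt|ge] := ltnP q.
  have -> : (size b).-1 = i + ((size b).-1 - i) by lia.
  rewrite iotaD count_cat [X in _ + X](_ : _ = 0) ?addn0.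
    by apply: leq_trans (count_size _ _) _; rewrite size_iota.
  apply/eqP; rewrite -leqn0 leqNgt -has_count; apply/hasPn => j.
  rewrite mem_iota /= -ltnNge => /andP[le _]; apply: leq_trans lt _.
  exact: leq_sumn_take.
apply/negbTE; rewrite -ltnNge.
have -> : (size b).-1 = i.+1 + ((size b).-1 - i.+1) by lia.
rewrite iotaD count_cat ltn_addr // (_ : count _ _ = i.+1) //.
apply/eqP; rewrite -[X in _ == X](size_iota 1) -all_count.
apply/allP => j; rewrite mem_iota => /andP[_ le].
by apply: leq_trans ge; apply: leq_sumn_take.
Qed.

Lemma bidx_eq q i : q < n ->
  (bidx q == i) = (sumn (take i b) <= q < sumn (take i.+1 b)).
Proof.
move=> lt_qn; rewrite eqn_leq bidx_leq // andbC; congr andb.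
by case: i => [|i]; [rewrite take0 | rewrite ltnNge bidx_leq // -leqNgt].
Qed.

Lemma bidx_ltn q : q < n -> bidx q < n.+1.
Proof.
move=> lt; rewrite ltnS bidx_leq // take_oversize ?sumn_pcomp //.
by case/andP: size_pcomp.
Qed.

Lemma card_block i : #|[set q : 'I_n | bidx q == i]| = nth 0 b i.
Proof.
have := card_ord_lt (sumn_take_pcomp i.+1).
rewrite -(cardsID [set q : 'I_n | q < sumn (take i b)]) sumn_takeS.
rewrite (_ : _ :&: _ = [set q : 'I_n | q < sumn (take i b)]); last first.
  by apply/setP => q; rewrite !inE; apply: andb_idl => lt; rewrite ltn_addr.
rewrite card_ord_lt ?sumn_take_pcomp // => /addnI <-.
by apply: eq_card => q; rewrite !inE bidx_eq // -leqNgt sumn_takeS.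
Qed.

End Blocks.

(** Ties blocks to descents: between neighbours the block index rises only at members of
    [psums b]. *)
Lemma bidxS b q : bidx b q.+1 = bidx b q + count_mem q.+1 (psums b).
Proof. by rewrite /bidx; elim: (psums b) => //= s l ->; lia. Qed.

(** * Signed permutations and words *)

Section SignedPerm.
Variables (n : nat).
Implicit Types (w : {perm 'I_n * bool}) (x : 'I_n * bool) (v q : 'I_n).

(* Order-isomorphic to [sval_of], with values in [0, 2n) since the value [0] is skipped. *)
Definition nval x : nat := if x.2 then n.-1 - x.1 else n + x.1.

Lemma nval_ltn x : nval x < 2 * n.
Proof. by case: x => v [] /=; rewrite /nval /=; have := ltn_ord v; lia. Qed.

Lemma nval_inj : injective nval.
Proof.
move=> [v e] [v' e']; rewrite /nval /= => E.
have lv := ltn_ord v; have lv' := ltn_ord v'.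
have ee : e = e' by case: (e) (e') E => [] [] /=; lia.
by subst e'; congr pair; apply: val_inj; case: (e) E => /=; lia.
Qed.

Lemma sval_of_ltn x y : (sval_of x < sval_of y)%R = (nval x < nval y).
Proof.
case: x y => [v e] [v' e']; rewrite /nval /sval_of /=.
have lv := ltn_ord v; have lv' := ltn_ord v'.
by case: e e' => [] []; lia.
Qed.

Lemma wat_ord w q : wat w q.+1 = sval_of (w (q, false)).
Proof. by rewrite /wat valK. Qed.

(** The position at which the absolute value [v] occurs in [w], with the sign it has there. *)
Definition wpos w v := (w^-1)%g (v, false).

Lemma signed_permP w : reflect (forall x, w (sneg x) = sneg (w x)) (is_signed_perm w).
Proof. by apply: (iffP forallP) => H x; apply/eqP; rewrite H. Qed.

Lemma signed_permV w : is_signed_perm w -> is_signed_perm (w^-1)%g.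
Proof.
move=> /signed_permP H; apply/signed_permP => x.
by apply: (@perm_inj _ w); rewrite permKV H permKV.
Qed.

Lemma wpos_abs w q : is_signed_perm w ->
  wpos w (w (q, false)).1 = (q, (w (q, false)).2).
Proof.
move=> sw; rewrite /wpos; case E: (w (q, false)) => [v []] /=; last by rewrite -E permK.
have /signed_permP H := signed_permV sw.
by rewrite -[(v, false)]/(sneg (v, true)) H -E permK.
Qed.

Lemma abs_wpos w v : is_signed_perm w -> (w ((wpos w v).1, false)).1 = v.
Proof.
move=> sw; rewrite /wpos; case E: ((w^-1)%g (v, false)) => [q e] /=.
have {}E : w (q, e) = (v, false) by rewrite -E permKV.
case: e E => [|->] // E; have /signed_permP H := sw.
by rewrite -[(q, false)]/(sneg (q, true)) H E.
Qed.

Lemma signed_perm_ext w w' : is_signed_perm w -> is_signed_perm w' ->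
  wpos w =1 wpos w' -> w = w'.
Proof.
move=> sw sw' E; apply: invg_inj; apply/permP => -[v []]; last exact: E.
rewrite -[(v, true)]/(sneg (v, false)).
have /signed_permP-> := signed_permV sw; have /signed_permP-> := signed_permV sw'.
by rewrite -!/(wpos _ _) E.
Qed.

(** A block and a sign; there are at most [n + 1] blocks, as only the first part can be 0. *)
Let J := ('I_n.+1 * bool)%type.
Implicit Types t : n.-tuple J.

(* Orders the signed values by block, then by size: the word [t] comes from the signed
   permutation which puts the absolute value [v] at position [rk t v]. *)
Definition key (t : n.-tuple J) v : nat :=
  (tnth t v).1 * (2 * n) + nval (v, (tnth t v).2).

(** Modulo [2 * n] the key gives back the signed value. *)
Lemma key_inj t : injective (key t).
Proof.
move=> v v' /(congr1 (modn^~ (2 * n))); rewrite !modnMDl !modn_small ?nval_ltn //.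
by move/nval_inj => [].
Qed.

Definition rk t v : nat := #|[set u | key t u < key t v]|.

Lemma rk_ltn t v : rk t v < n.
Proof.
rewrite -[X in _ < X]card_ord -cardsT; apply: proper_card.
by rewrite properE subsetT; apply/subsetPn; exists v; rewrite ?inE // ltnn.
Qed.

Lemma rk_mono t u v : key t u < key t v -> rk t u < rk t v.
Proof.
move=> lt; apply: proper_card; rewrite properE; apply/andP; split.
  by apply/subsetP => x; rewrite !inE => /ltn_trans; apply.
by apply/subsetPn; exists u; rewrite ?inE ?ltnn.
Qed.

Lemma rk_key t u v : rk t u < rk t v -> key t u < key t v.
Proof.
move=> lt; rewrite ltnNge leq_eqVlt; apply/negP => /orP[/eqP/key_inj E|/rk_mono].
  by rewrite E ltnn in lt.
by rewrite ltnNge (ltnW lt).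
Qed.

Lemma rk_inj t : injective (rk t).
Proof.
move=> u v E; apply: (@key_inj t).
by case: (ltngtP (key t u) (key t v)) => // /rk_mono; rewrite E ltnn.
Qed.

Lemma key_ltn_block t u v : (tnth t u).1 < (tnth t v).1 -> key t u < key t v.
Proof.
move=> lt; have := leq_mul lt (leqnn (2 * n)).
have := nval_ltn (u, (tnth t u).2); rewrite /key (mulSn (tnth t u).1).
lia.
Qed.

Variable b : seq nat.
Hypothesis comp_b : is_pcomp n b.

Definition word w : n.-tuple J :=
  [tuple (inord (bidx b (wpos w v).1), (wpos w v).2) | v < n].

(** In block 0 the values increase from [w(0) = 0], so they are positive. *)
Definition letter (x : J) := (x.1 == ord0) ==> ~~ x.2.

Definition bsize (i : 'I_n.+1) := nth 0 b i.

Definition is_word (t : n.-tuple J) := all letter t && has_content fst bsize t.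

(** Descents occur only at block boundaries, so the values increase inside each block. *)
Definition sorted_perm w := is_signed_perm w && (sdes w \subset pdes n b).

Lemma key_word w q : is_signed_perm w ->
  key (word w) (w (q, false)).1 = bidx b q * (2 * n) + nval (w (q, false)).
Proof.
by move=> sw; rewrite /key tnth_mktuple wpos_abs //= inordK ?bidx_ltn.
Qed.

(** Between neighbouring positions either a boundary is passed and the block dominates the key, or
    no descent is allowed and the value grows. *)
Lemma key_word_mono w : sorted_perm w -> forall q q', q < q' ->
  key (word w) (w (q, false)).1 < key (word w) (w (q', false)).1.
Proof.
move=> /andP[sw des] q q' lt.
(* Extended by 0 to all of [nat], so that only successive positions need comparing. *)
pose k i := if insub i is Some q then key (word w) (w (q, false)).1 else 0.
have kE r : key (word w) (w (r, false)).1 = k r by rewrite /k valK.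
rewrite !kE.
refine (homo_ltn_in (D := [pred i | i < n]) (r := fun k l => k < l) _ _ _ _ _ lt);
  rewrite ?inE //.
- by move=> l j m; apply: ltn_trans.
- by move=> i j _; rewrite inE => ltj l /andP[_ /ltn_trans]; apply.
move=> i; rewrite !inE => lti ltSi.
have -> : i = Ordinal lti by [].
have -> : i.+1 = Ordinal ltSi by [].
rewrite -!kE !key_word //= bidxS.
set x := w (Ordinal lti, false); set y := w (Ordinal ltSi, false).
have lx := nval_ltn x.
case: (ltnP 0 (count_mem i.+1 (psums b))) => [c|]; first nia.
rewrite leqn0 => /eqP c; rewrite c addn0 ltn_add2l.
rewrite ltn_neqAle (inj_eq nval_inj) (inj_eq perm_inj) xpair_eqE eqxx andbT.
apply/andP; split; first by rewrite -val_eqE /= ltn_eqF.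
rewrite leqNgt -sval_of_ltn -!wat_ord /=; apply/negP => D.
have : Ordinal ltSi \in pdes n b by apply: (subsetP des); rewrite inE.
by rewrite inE -has_pred1 has_count c.
Qed.

(** Keys increase along positions, so the number of smaller keys is the position itself; this
    recovers [w] from its word. *)
Lemma rk_word w v : sorted_perm w -> rk (word w) v = (wpos w v).1.
Proof.
move=> Hw; have /andP[sw _] := Hw.
set q0 := (wpos w v).1; have Ev : v = (w (q0, false)).1 by rewrite abs_wpos.
pose f q := (w (q, false)).1.
have f_inj : injective f.
  by move=> q q' /(congr1 (wpos w)); rewrite !wpos_abs // => -[].
rewrite -(card_ord_lt (ltnW (ltn_ord q0))) -(card_imset _ f_inj); apply: eq_card => u; rewrite inE.
rewrite -[u in LHS](abs_wpos _ sw) Ev; apply/idP/imsetP => [lt|[q]].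
  exists (wpos w u).1; last by rewrite /f abs_wpos.
  rewrite inE ltnNge leq_eqVlt; apply/negP => /orP[/eqP/val_inj E|/(key_word_mono Hw)].
    by rewrite -E ltnn in lt.
  by rewrite ltnNge (ltnW lt).
rewrite inE => lt ->; rewrite abs_wpos //; exact: key_word_mono.
Qed.

Lemma word_inj : {in sorted_perm &, injective word}.
Proof.
move=> w w' Hw Hw' E; have /andP[sw _] := Hw; have /andP[sw' _] := Hw'.
apply: signed_perm_ext => // v.
have := rk_word v Hw; rewrite E rk_word // => /val_inj E1.
have := congr1 (fun t => (tnth t v).2) E; rewrite !tnth_mktuple /=.
by move: E1; case: (wpos w v) (wpos w' v) => [a e] [a' e'] /= -> ->.
Qed.

Lemma count_tnth (T : eqType) (P : pred T) (t : n.-tuple T) :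
  count P t = #|[set v | P (tnth t v)]|.
Proof. by rewrite -sum1_count big_tuple sum1dep_card. Qed.

Lemma word_is_word w : sorted_perm w -> is_word (word w).
Proof.
move=> Hw; have /andP[sw des] := Hw; apply/andP; split.
  apply/all_tnthP => v; rewrite tnth_mktuple /letter /=; apply/implyP => /eqP/(congr1 val).
  rewrite /= inordK ?bidx_ltn // => q0; apply/negP => neg.
  set q := (wpos w v).1 in q0.
  have n_gt0 : 0 < n by case: (n) (v) => [[]|].
  (* A negative value in block 0 would make the value at the first position negative as well; then 0
     is a descent, hence a boundary, and the first position is not in block 0. *)
  pose o : 'I_n := Ordinal n_gt0.
  have Ev : w (q, false) = (v, true).
    have : (w (q, false)).1 = v by rewrite abs_wpos.
    have := wpos_abs q sw; case: (w (q, false)) => v' e /= E1 Ev'.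
    by rewrite -Ev'; move: neg; rewrite -Ev' E1 /= => ->.
  have o0 : bidx b o = 0.
    by apply/eqP; rewrite -leqn0 -q0; apply: sub_count => s /= /leq_trans; apply.
  have le : nval (w (o, false)) <= nval (w (q, false)).
    have [->//|ne] := eqVneq o q.
    have lt : o < q by rewrite lt0n eq_sym; rewrite -val_eqE in ne.
    have := key_word_mono Hw lt; rewrite !key_word // o0 /= q0 !add0n; exact: ltnW.
  have neg0 : (sval_of (w (o, false)) < 0)%R.
    move: le; rewrite Ev /nval /sval_of /=; case: (w _) => u [] //=.
    have := ltn_ord v; lia.
  have : o \in pdes n b by apply: (subsetP des); rewrite inE wat_ord.
  rewrite inE => h; have : has (fun s => s <= o) (psums b) by apply/hasP; exists 0.
  by rewrite has_count -/(bidx b o) o0.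
(* Sending a position [q] to the absolute value of [w] there matches the positions of block [i] with
   its letters. *)
apply/forallP => i; rewrite count_tnth /bsize -(card_block comp_b).
have inj : injective (fun q => (w (q, false)).1).
  by move=> q q' /(congr1 (wpos w)); rewrite !wpos_abs // => -[].
rewrite -(card_imset [set q : 'I_n | bidx b q == i] inj).
apply/eqP; apply: eq_card => v; rewrite inE tnth_mktuple /=.
have lt q : bidx b q < n.+1 by apply: bidx_ltn.
apply/eqP/imsetP => [E|[q]].
  by exists (wpos w v).1; rewrite ?abs_wpos // inE -E /= inordK.
by rewrite inE => /eqP E ->; rewrite wpos_abs //; apply: val_inj; rewrite /= inordK.
Qed.

Lemma card_blocks_below t m : is_word t -> m <= n.+1 ->
  #|[set v | (tnth t v).1 < m]| = sumn (take m b).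
Proof.
move=> /andP[_ /forallP cont]; elim: m => [|m IH] lt.
  by rewrite take0; apply: eq_card0 => v; rewrite inE.
rewrite sumn_takeS -IH ?(ltnW lt) // -(cardsID [set v | (tnth t v).1 < m]).
congr (_ + _).
  by apply: eq_card => v; rewrite !inE; apply: andb_idl => /ltnW.
have /eqP := cont (Ordinal lt); rewrite count_tnth /bsize /= => <-.
by apply: eq_card => v; rewrite !inE -leqNgt ltnS -eqn_leq eq_sym.
Qed.

(** Letters of smaller blocks have smaller keys and letters of larger blocks larger ones, so the
    rank falls within the block of [v]. *)
Lemma bidx_rk t v : is_word t -> bidx b (rk t v) = (tnth t v).1.
Proof.
move=> Ht; set i := (tnth t v).1; apply/eqP; rewrite (bidx_eq comp_b) ?rk_ltn //.
have lti := ltn_ord i.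
rewrite -!(card_blocks_below Ht) ?(ltnW lti) //; apply/andP; split.
  by apply: subset_leq_card; apply/subsetP => u; rewrite !inE; apply: key_ltn_block.
apply: proper_card; rewrite properE; apply/andP; split; last first.
  by apply/subsetPn; exists v; rewrite ?inE // ltnn.
apply/subsetP => u; rewrite !inE ltnS => lt; rewrite leqNgt.
by apply/negP => /key_ltn_block; rewrite ltnNge ltnW.
Qed.

(** The inverse of the permutation sought: a signed value goes to its signed position. *)
Definition unword_fun t x := (Ordinal (rk_ltn t x.1), x.2 (+) (tnth t x.1).2).

Lemma unword_fun_inj t : injective (unword_fun t).
Proof.
move=> [u e] [v e'] [] /= /rk_inj ->; first by move=> /addIb ->.
Qed.

Definition unword t : {perm 'I_n * bool} := ((perm (@unword_fun_inj t))^-1)%g.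

Lemma wpos_unword t v : wpos (unword t) v = (Ordinal (rk_ltn t v), (tnth t v).2).
Proof. by rewrite /wpos /unword invgK permE. Qed.

Lemma unword_signed t : is_signed_perm (unword t).
Proof.
apply: signed_permV; apply/signed_permP => -[v e].
by rewrite !permE /unword_fun /sneg /= addNb.
Qed.

Lemma wordK t : is_word t -> word (unword t) = t.
Proof.
move=> Ht; apply: eq_from_tnth => v; rewrite tnth_mktuple wpos_unword /= bidx_rk //.
by rewrite inord_val; case: (tnth t v).
Qed.

Lemma unword_sorted t : is_word t -> sorted_perm (unword t).
Proof.
move=> Ht; have sw := unword_signed t; rewrite /sorted_perm sw.
set w := unword t in sw *; apply/subsetP => -[i lti]; rewrite !inE wat_ord.
have rkE q : rk t (w (q, false)).1 = q.
  by have := wpos_abs q sw; rewrite wpos_unword => -[/(congr1 val)].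
have sgn q : (tnth t (w (q, false)).1).2 = (w (q, false)).2.
  by have := wpos_abs q sw; rewrite wpos_unword => -[_].
case: i lti => [|i] lti.
  (* A descent at 0 makes the first value negative; its letter is then outside block 0, which forces
     0 to be a boundary. *)
  move=> neg.
  set v := (w (Ordinal lti, false)).1.
  have v_neg : (tnth t v).2 by rewrite sgn; move: neg; rewrite /sval_of; case: ifP.
  have /andP[/all_tnthP/(_ v) + _] := Ht; rewrite /letter v_neg implybF => ne0.
  have : 0 < bidx b 0.
    by have := bidx_rk v Ht; rewrite rkE /= => ->; rewrite lt0n.
  by rewrite -has_count => /hasP[s s_in]; rewrite leqn0 => /eqP s0; rewrite s0 in s_in.
have lt' := ltnW lti.
rewrite -[X in (_ < wat w X)%R]/((Ordinal lt').+1 : nat) wat_ord sval_of_ltn.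
set x := w _; set y := w _ => lt.
have : key t y.1 < key t x.1 by apply: rk_key; rewrite !rkE.
(* Without a boundary at [i.+1] both positions share a block, where keys are ordered as values. *)
apply: contraLR => nin; rewrite -leqNgt /key -!bidx_rk // !rkE /= bidxS.
have -> : count_mem i.+1 (psums b) = 0.
  by apply/eqP; rewrite -leqn0 leqNgt -has_count has_pred1.
rewrite addn0 leq_add2l !sgn -/x -/y.
by move: (x) (y) lt => [? ?] [? ?] /=; apply: ltnW.
Qed.

Lemma card_sorted_perm : #|[set w | sorted_perm w]| = multinomB n b.
Proof.
have -> : #|[set w | sorted_perm w]| = #|[set t | is_word t]|.
  rewrite -(@card_in_imset _ _ word); last by move=> w w'; rewrite !inE; apply: word_inj.
  apply: eq_card => t; rewrite inE; apply/imsetP/idP => [[w + ->]|Ht].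
    by rewrite inE; apply: word_is_word.
  by exists (unword t); rewrite ?wordK // inE unword_sorted.
have [b0 b_sz] := andP (size_pcomp comp_b); have b_sum := sumn_pcomp comp_b.
(* Beyond the end of [b] the default part 0 adds nothing to the sum and a factor [0! = 1] to the
   product. *)
have sum_bsize : \sum_i bsize i = n.
  apply/esym; rewrite -[LHS]b_sum sumnE (big_nth 0) big_mkord (big_ord_widen _ (nth 0 b) b_sz).
  rewrite big_mkcond /=; apply: eq_bigr => i _; case: ifP => // /negbT.
  by rewrite -leqNgt /bsize => /(nth_default 0).
have prod_bsize : \prod_i (bsize i)`! = \prod_(x <- b) x`!.
  apply/esym; rewrite (big_nth 0) big_mkord (big_ord_widen _ (fun i => (nth 0 b i)`!) b_sz).
  rewrite big_mkcond /=; apply: eq_bigr => i _; case: ifP => // /negbT.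
  by rewrite -leqNgt /bsize => /(nth_default 0) ->.
apply/eqP; rewrite -(eqn_pmul2r (prod_fact_gt0 b)) -{1}prod_bsize (card_words _ _ sum_bsize).
have fact := multinom_fact b; rewrite b_sum in fact.
rewrite /multinomB -mulnA fact mulnC.
rewrite big_ord_recl; apply/eqP; congr (_ * _).
(* Block 0 offers one letter and each other block two, whence the exponent [n - b_1]. *)
have -> : #|[set x : J | letter x & x.1 == ord0]| = 1.
  rewrite -(cards1 ((ord0, false) : J)); apply: eq_card => -[i e].
  by rewrite !inE /letter xpair_eqE /=; case: (i == _) => //=; case: e.
rewrite exp1n mul1n (eq_bigr (fun i => 2 ^ bsize (lift ord0 i))) => [|i _]; last first.
  rewrite (_ : [set _ | _] = [set (lift ord0 i, true); (lift ord0 i, false)])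
    ?cards2 ?xpair_eqE ?andbF //.
  apply/setP => -[j e]; rewrite !inE /letter !xpair_eqE /=.
  by case: (eqVneq j (lift ord0 i)) => [->|_]; rewrite ?andbF //=; case: e.
rewrite -expn_sum; congr (_ ^ _).
by move: sum_bsize; rewrite big_ord_recl {1}/bsize /= nth0; lia.
Qed.

End SignedPerm.

(** * Pseudo-compositions and sets of descents *)

Lemma uniq_flatten_size (T : eqType) (r : seq nat) (f : nat -> seq (seq T)) :
  uniq r -> (forall l, uniq (f l)) -> (forall l s, s \in f l -> size s = l) ->
  uniq (flatten [seq f l | l <- r]).
Proof.
move=> + uf sz; elim: r => //= l r IH /andP[nl ur]; rewrite cat_uniq uf IH // andbT.
apply/hasPn => s /flattenP[_ /mapP[l' l'r ->] s_in]; apply/negP => /sz s_l.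
by move: nl; rewrite -s_l (sz _ _ s_in) l'r.
Qed.

Lemma mem_pcomps (n : nat) (b : seq nat) : (b \in pcomps n) = is_pcomp n b.
Proof.
apply/flattenP/idP => [[_ /mapP[l _ ->]]|comp_b]; first by rewrite mem_filter => /andP[].
have /andP[_ sz] := size_pcomp comp_b.
exists [seq s <- [seq map val (tval t) | t <- enum {: (size b).-tuple 'I_n.+1}] | is_pcomp n s].
  by apply/mapP; exists (size b); rewrite // mem_iota.
rewrite mem_filter comp_b; apply/mapP.
have szt : size [seq inord x : 'I_n.+1 | x <- b] == size b by rewrite size_map.
exists (Tuple szt); rewrite ?mem_enum //= -map_comp map_id_in // => x x_in /=.
rewrite inordK // ltnS -(sumn_pcomp comp_b).
by elim: (b) x_in => //= y s IH; rewrite inE => /orP[/eqP <-|/IH]; lia.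
Qed.

Lemma pcomps_uniq (n : nat) : uniq (pcomps n).
Proof.
apply: uniq_flatten_size => [|l|l s]; first exact: iota_uniq.
  rewrite filter_uniq // map_inj_uniq ?enum_uniq // => t t' E; apply: val_inj.
  by apply: inj_map E; apply: val_inj.
by rewrite mem_filter => /andP[_ /mapP[t _ ->]]; rewrite size_map size_tuple.
Qed.

Lemma scanl_addn (b : seq nat) (x : nat) :
  scanl addn x b = [seq x + sumn (take j b) | j <- iota 1 (size b)].
Proof.
elim: b x => //= y b IH x; rewrite take0 /= addn0; congr cons.
rewrite IH -[2]addn1 addnC iotaDl -map_comp; apply: eq_map => j /=.
by rewrite add0n; lia.
Qed.

Lemma rcons_psums (n : nat) (b : seq nat) : is_pcomp n b ->
  rcons (psums b) n = scanl addn 0 b.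
Proof.
move=> comp_b; have /andP[sz _] := size_pcomp comp_b.
rewrite scanl_addn -[X in iota 1 X](prednK sz) -[X in iota 1 X]addn1 iotaD map_cat /=
  add1n prednK //.
by rewrite take_oversize // (sumn_pcomp comp_b) cats1.
Qed.

Lemma sorted_psums (n : nat) (b : seq nat) : is_pcomp n b ->
  sorted ltn (rcons (psums b) n).
Proof.
move=> comp_b; rewrite (rcons_psums comp_b); case/and3P: comp_b.
case: b => //= y s _ + _; rewrite add0n.
by elim: s y => //= z s IH y /andP[z0 /IH ->]; rewrite andbT -[X in X < _]addn0 ltn_add2l.
Qed.

Lemma psums_ltn (n : nat) (b : seq nat) : is_pcomp n b ->
  sorted ltn (psums b) /\ {in psums b, forall s, s < n}.
Proof.
move=> /sorted_psums; rewrite !(sorted_pairwise ltn_trans) pairwise_rcons.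
by case/andP => /allP lt ?; split.
Qed.

(** A strictly increasing list is determined by its members, and [b] by its partial sums, since
    [scanl addn] can be undone. *)
Lemma pdes_inj (n : nat) : {in pcomps n &, injective (pdes n)}.
Proof.
move=> b b'; rewrite !mem_pcomps => Hb Hb' E.
have [srt lt] := psums_ltn Hb; have [srt' lt'] := psums_ltn Hb'.
have Eps : psums b = psums b'.
  apply: (irr_sorted_eq ltn_trans ltnn) => // s; apply/idP/idP => s_in.
    have : Ordinal (lt _ s_in) \in pdes n b by rewrite inE.
    by rewrite E inE.
  have : Ordinal (lt' _ s_in) \in pdes n b' by rewrite inE.
  by rewrite -E inE.
have := rcons_psums Hb'; rewrite -Eps (rcons_psums Hb).
have K : forall x, cancel (addn x) (subn^~ x) by move=> x y; rewrite addKn.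
by move=> /(can_inj (scanlK K 0)).
Qed.

Lemma pdes_surj (n : nat) (S : {set 'I_n}) : exists2 b, is_pcomp n b & pdes n b = S.
Proof.
pose l := [seq val i | i <- enum S].
have srt : sorted ltn (rcons l n).
  have srt : sorted ltn l.
    rewrite sorted_map /enum_mem -enumT; apply: sorted_filter.
      by move=> x y z; apply: ltn_trans.
    by have := iota_ltn_sorted 0 n; rewrite -val_enum_ord sorted_map.
  rewrite !(sorted_pairwise ltn_trans) pairwise_rcons -(sorted_pairwise ltn_trans) srt andbT.
  by apply/allP => _ /mapP[i _ ->]; apply: (ltn_ord i).
(* The parts are the gaps between 0, the elements of [S] in order, and [n]; the first gap is 0 when
   0 lies in [S]. *)
pose b := pairmap (fun x y => y - x) 0 (rcons l n).
have scan s x : path leq x s -> scanl addn x (pairmap (fun x y => y - x) x s) = s.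
  by elim: s x => //= y s IH x /andP[le /IH]; rewrite subnKC // => ->.
have scan_b : scanl addn 0 b = rcons l n.
  apply: scan; rewrite path_min_sorted; first by apply: sub_sorted srt => x y /ltnW.
  exact/allP.
have b_pos : all (fun x => 0 < x) (behead b).
  rewrite /b; case: (rcons l n) srt => //= y s.
  by elim: s y => //= z s IH y /andP[lt /IH ->]; rewrite subn_gt0 lt.
have b_sz : size b = (size l).+1 by rewrite size_pairmap size_rcons.
have b_sum : sumn b = n.
  have := congr1 (last 0) scan_b; rewrite last_rcons scanl_addn b_sz.
  rewrite -[X in iota 1 X]addn1 iotaD map_cat last_cat /=.
  by rewrite add1n -b_sz take_size.
have comp_b : is_pcomp n b by rewrite /is_pcomp b_sz b_pos b_sum eqxx.
exists b => //; apply/setP => i; rewrite inE.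
have := rcons_psums comp_b; rewrite scan_b => /rcons_inj/(congr1 fst) /= ->.
by rewrite (mem_map val_inj) mem_enum.
Qed.

Lemma perm_pdes (n : nat) : perm_eq [seq pdes n b | b <- pcomps n] (enum {set 'I_n}).
Proof.
apply: uniq_perm; rewrite ?enum_uniq ?(map_inj_in_uniq (@pdes_inj n)) ?pcomps_uniq //.
move=> S; rewrite mem_enum; apply/mapP.
by have [b Hb <-] := pdes_surj S; exists b; rewrite ?mem_pcomps.
Qed.

(** * Inversion over the Boolean lattice *)

Section Moebius.
Local Open Scope ring_scope.
Variables (I : finType) (R : comNzRingType).
Implicit Types S T U : {set I}.

(** For [U != S], toggling an element of [S] outside [U] pairs terms of opposite signs. *)
Lemma sum_sign_interval S U : U \subset S ->
  \sum_(T : {set I} | (U \subset T) && (T \subset S)) (-1) ^+ (#|S| - #|T|)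
  = (U == S)%:R :> R.
Proof.
move=> US; have [<-|neq] := eqVneq U S.
  rewrite (big_pred1 U) ?subnn ?expr0 // => T.
  by rewrite andbC -eqEsubset eq_sym.
have [x xS xU] : exists2 x, x \in S & x \notin U.
  by apply/subsetPn; apply: contraNN neq => SU; rewrite eqEsubset US.
rewrite (bigID (fun T : {set I} => x \in T)) /=.
rewrite (reindex_onto (fun T => x |: T) (fun T => T :\ x)) /=; last first.
  by move=> T /andP[_ xT]; rewrite setD1K.
apply/eqP; rewrite addr_eq0 -sumrN; apply/eqP.
apply: eq_big => [T|T /andP[/andP[/andP[_ xTS] _] TD]].
  rewrite setU11 andbT; have [xT|xT] := boolP (x \in T).
    rewrite andbF; apply/negbTE; rewrite negb_and; apply/orP; right.
    by apply/eqP => E; move: xT; rewrite -E setD11.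
  rewrite setU1K // eqxx !andbT subUset sub1set xS /=; congr andb.
  apply/idP/idP => [|h]; last exact: subset_trans h (subsetUr _ _).
  move=> /subsetP h; apply/subsetP => y yU; have := h y yU.
  by rewrite !inE => /predU1P[E|//]; rewrite -E yU in xU.
have xT : x \notin T by rewrite -(eqP TD) setD11.
have := subset_leq_card xTS; rewrite cardsU1 xT add1n => lt.
by rewrite -[in RHS](subnSK lt) exprS mulN1r opprK.
Qed.

(** After exchanging the sums, the coefficient of [f U] is the alternating sum over the interval
    from [U] to [S], which singles out [U = S]. *)
Lemma moebius (f g : {set I} -> R) :
  (forall T, g T = \sum_(U : {set I} | U \subset T) f U) ->
  forall S, f S = \sum_(T : {set I} | T \subset S) (-1) ^+ (#|S| - #|T|) * g T.
Proof.
move=> fg S; under eq_bigr do rewrite fg big_distrr /=.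
rewrite (exchange_big_dep (fun U : {set I} => U \subset S)) /=; last first.
  by move=> T U TS UT; apply: subset_trans UT TS.
transitivity (\sum_(U : {set I} | U \subset S) (U == S)%:R * f U).
  rewrite (bigD1 S) //= eqxx mul1r big1 ?addr0 // => U /andP[_ /negbTE->].
  by rewrite mul0r.
apply: eq_bigr => U US; rewrite -(sum_sign_interval US) big_distrl /=.
by apply: eq_bigl => T; rewrite andbC.
Qed.

End Moebius.

(** [S] consists of [S :&: P], on which alone the condition depends, and an arbitrary subset of the
    complement. *)
Lemma card_setI_preim (I : finType) (P : {set I}) (Q : pred {set I}) :
  #|[set S : {set I} | Q (S :&: P)]| = 2 ^ #|~: P| * #|[set T : {set I} | (T \subset P) && Q T]|.
Proof.
pose D := setX [set T : {set I} | (T \subset P) && Q T] (powerset (~: P)).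
have K (T U : {set I}) : T \subset P -> U \subset ~: P ->
    ((T :|: U) :&: P, (T :|: U) :\: P) = (T, U).
  move=> TP UP; have d : [disjoint U & P] by rewrite disjoints_subset.
  rewrite setIUl (setIidPl TP) (disjoint_setI0 d) setU0 setDUl.
  have /eqP -> : T :\: P == set0 by rewrite setD_eq0.
  by rewrite set0U setDE (setIidPl UP).
have inj : {in D &, injective (fun TU => TU.1 :|: TU.2)}.
  move=> [T U] [T' U']; rewrite !inE /= => /andP[/andP[TP _] UP] /andP[/andP[TP' _] UP'] E.
  by rewrite -(K T U) // E K.
rewrite mulnC -card_powerset -cardsX -(card_in_imset inj).
apply: eq_card => S; rewrite !inE; apply/idP/imsetP => [QS|[[T U]]].
  exists (S :&: P, S :\: P); last by rewrite /= setID.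
  by rewrite !inE /= subsetIr QS setDE subsetIr.
rewrite !inE /= => /andP[/andP[TP QT] UP] ->.
have d : [disjoint U & P] by rewrite disjoints_subset.
by rewrite setIUl (setIidPl TP) (disjoint_setI0 d) setU0.
Qed.

(** * Ribbon numbers modulo a prime *)

Lemma eqz_mod_Fp (p : nat) (z z' : int) : prime p ->
  (z == z' %[mod Posz p])%Z = (z%:~R == z'%:~R :> 'F_p)%R.
Proof.
move=> pr; rewrite eqz_mod_dvd (dvdz_pcharf (pchar_Fp pr)).
by rewrite intrB subr_eq0.
Qed.

Lemma eqn_mod_Fp (p a c : nat) : prime p ->
  (a == c %[mod p]) = (a%:R == c%:R :> 'F_p)%R.
Proof. by move=> pr; rewrite !pmulrn -eqz_mod_Fp // !modz_nat. Qed.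

Lemma sum_digits (p m k : nat) : m < p ^ k -> m = \sum_(j < k) digit p m j * p ^ j.
Proof.
elim: k m => [|k IH] m.
  by rewrite expn0 big_ord0; case: m.
move=> lt; have p_gt0 : 0 < p by case: (posnP p) lt => [->|] //; rewrite exp0n.
rewrite big_ord_recl /digit expn0 divn1 muln1 {1}(divn_eq m p) addnC; congr addn.
rewrite {1}(IH (m %/ p)) ?ltn_divLR -?expnSr // big_distrl; apply: eq_bigr => j _.
by rewrite lift0 /digit expnS divnMA /= -mulnA (mulnC (p ^ j)).
Qed.

(** The ribbon number indexed by its descent set, which determines the pseudo-composition. *)
Definition ribbon (n : nat) (S : {set 'I_n}) : nat :=
  #|[set w : {perm 'I_n * bool} | is_signed_perm w && (sdes w == S)]|.

Lemma cB_ribbon (p i n : nat) : cB p i n = #|[set S : {set 'I_n} | ribbon S %% p == i]|.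
Proof.
rewrite /cB -(count_map _ (fun S : {set 'I_n} => ribbon S %% p == i)).
have /seq.permP -> := perm_pdes n.
by rewrite -sum1_card -sum1_count big_enum_cond; apply: eq_bigl => S; rewrite inE.
Qed.

Lemma sum_ribbon (n : nat) (b : seq nat) : is_pcomp n b ->
  \sum_(U : {set 'I_n} | U \subset pdes n b) ribbon U = multinomB n b.
Proof.
move=> comp_b; rewrite -card_sorted_perm // -sum1dep_card.
rewrite (partition_big (@sdes n) (fun U => U \subset pdes n b)) => [|w /andP[]] //=.
apply: eq_bigr => U US; rewrite /ribbon -sum1dep_card; apply: eq_bigl => w.
rewrite /sorted_perm -andbA; congr andb.
by case: eqP => [->|]; rewrite ?andbF // US.
Qed.

Section ModP.
Local Open Scope ring_scope.
Variables (p n : nat).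
Hypothesis pr : prime p.
Implicit Types (S T U : {set 'I_n}) (b : seq nat).

Let p_gt1 := prime_gt1 pr.
Let n_ltn : (n < p ^ (topk p n).+1)%N := trunc_log_ltn n p_gt1.

Lemma pcomp_leq b : is_pcomp n b -> all (fun x => (x <= n)%N) b.
Proof.
move=> comp_b; apply/allP => x; rewrite -(sumn_pcomp comp_b).
by elim: (b) => //= y s IH; rewrite inE => /orP[/eqP ->|/IH]; lia.
Qed.

Lemma multinomB_Fp b : is_pcomp n b -> (multinomB n b)%:R =
  (\prod_(j < (topk p n).+1) multinomB (digit p n j) [seq digit p x j | x <- b])%:R :> 'F_p.
Proof.
move=> comp_b; apply/eqP; rewrite -eqn_mod_Fp //.
by rewrite (multinomB_digits pr n_ltn) ?pcomp_leq.
Qed.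

(** All digit factors are nonzero, so the digits of the parts add up to those of [n] without
    carries; hence every partial sum has digits at most those of [n]. *)
Lemma multinomB_Pset b : is_pcomp n b -> (multinomB n b)%:R != 0 :> 'F_p ->
  pdes n b \subset Pset p n.
Proof.
move=> comp_b; rewrite multinomB_Fp // natr_prod prodf_seq_neq0 /= => /allP ne0.
have sum_digit j : (j < (topk p n).+1)%N -> sumn [seq digit p x j | x <- b] = digit p n j.
  move=> lt; have := ne0 (Ordinal lt); rewrite mem_index_enum => /(_ isT).
  rewrite /multinomB /multinom /=; case: (sumn _ =P digit p n j) => // _.
  by rewrite muln0 eqxx.
apply/subsetP => m; rewrite inE => /mapP[l _ Em].
pose c j := sumn [seq digit p x j | x <- take l b].
have le_c (j : 'I_(topk p n).+1) : (c j <= digit p n j)%N.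
  rewrite -(sum_digit j (ltn_ord j)) /c map_take -{2}(cat_take_drop l [seq _ | _ <- b]).
  by rewrite sumn_cat leq_addr.
have lt_c (j : 'I_(topk p n).+1) : (c j < p)%N.
  by apply: leq_ltn_trans (le_c j) _; apply: ltn_pmod; apply: prime_gt0.
rewrite inE; apply/existsP; exists [ffun j => Ordinal (lt_c j)].
apply/andP; split; first by apply/forallP => j; rewrite ffunE /=.
rewrite Em (eq_bigr (fun j : 'I_(topk p n).+1 => c j * p ^ j)%N) => [|j _]; last by rewrite ffunE.
rewrite sumnE.
have H x : x \in take l b -> x = (\sum_(j < (topk p n).+1) digit p x j * p ^ j)%N.
  move=> /mem_take x_in; apply: sum_digits; apply: leq_ltn_trans n_ltn.
  by move/allP: (pcomp_leq comp_b); apply.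
rewrite big_seq (eq_bigr _ H) -big_seq exchange_big /=; apply/eqP.
by apply: eq_bigr => j _; rewrite /c sumnE big_map big_distrl.
Qed.

(** The number a(T) of signed permutations with descents confined to [T], modulo [p]. *)
Definition below T : 'F_p := \sum_(U : {set 'I_n} | U \subset T) (ribbon U)%:R.

Lemma below_pdes b : is_pcomp n b -> below (pdes n b) = (multinomB n b)%:R.
Proof. by move=> comp_b; rewrite -sum_ribbon // natr_sum. Qed.

Lemma below_neq0 T : below T != 0 -> T \subset Pset p n.
Proof. by have [b Hb <-] := pdes_surj T; rewrite below_pdes //; apply: multinomB_Pset. Qed.

Lemma ribbon_below S : (ribbon S)%:R =
  \sum_(T : {set 'I_n} | T \subset S) (-1) ^+ (#|S| - #|T|) * below T :> 'F_p.
Proof. exact: (moebius (fun T => erefl (below T))). Qed.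

(** Both sides are the same alternating sum over subsets of [T]: the terms that [rB] leaves out
    contain a digit multinomial equal to 0. *)
Lemma rB_ribbon T : (rB p T)%:~R = (ribbon T)%:R :> 'F_p.
Proof.
rewrite ribbon_below; transitivity (\sum_(U <- enum {set 'I_n} | U \subset T)
  (-1) ^+ (#|T| - #|U|) * below U); last by rewrite big_enum_cond.
rewrite -(perm_big _ (perm_pdes n)) /= big_map.
rewrite /rB rmorph_sum /= [LHS]big_mkcondr [LHS]big_seq_cond [RHS]big_seq_cond.
apply: eq_bigr => b; rewrite mem_pcomps => /andP[comp_b _].
rewrite below_pdes // multinomB_Fp //.
set D := [forall _, _]; have [HD|] := boolP D.
  rewrite rmorphM rmorph_sign /=; congr (_ * _).
  rewrite -pmulrn; congr (_ %:R); apply: eq_bigr => j _.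
  (* The head of the digit list is the digit of the head, also for the default, as 0 has digit 0. *)
  by congr (2 ^ (_ - _) * _)%N; case: (b) => //=; rewrite /digit div0n mod0n.
rewrite negb_forall => /existsP[j /negbTE nj].
rewrite (bigD1 j) //= {1}/multinomB /multinom nj muln0 mul0n.
by rewrite mulr0.
Qed.

(** Only subsets of [P] contribute to the inversion formula, so passing from [S] to [S :&: P]
    affects only the sign, through the size of [S :\: P]. *)
Lemma ribbon_Pset S :
  (ribbon S)%:R = (-1) ^+ #|S :\: Pset p n| * (ribbon (S :&: Pset p n))%:R :> 'F_p.
Proof.
rewrite !ribbon_below big_distrr /= (bigID (fun T : {set 'I_n} => T \subset Pset p n)) /=.
rewrite [X in _ + X]big1 ?addr0 => [|T /andP[_ nP]]; last first.
  by have [->|/below_neq0] := eqVneq (below T) 0; rewrite ?mulr0 // (negbTE nP).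
apply: eq_big => [T|T /andP[TS TP]]; first by rewrite subsetI.
rewrite mulrA -exprD; congr (_ ^+ _ * _).
rewrite -(cardsID (Pset p n) S) addnC addnBA //; apply: subset_leq_card.
by rewrite subsetI TS.
Qed.

End ModP.

(** * Base-[p] digits and the set [P] *)

Lemma digit_eq (p m k : nat) (c : 'I_k -> nat) : (forall j, c j < p) ->
  m = \sum_(j < k) c j * p ^ j -> forall j : 'I_k, digit p m j = c j.
Proof.
elim: k m c => [m c _ _ []//|k IH] m c lt.
rewrite big_ord_recl expn0 muln1 => Em.
have p_gt0 : 0 < p by apply: leq_ltn_trans (lt ord0).
have {}Em : m = (\sum_(j < k) c (lift ord0 j) * p ^ j) * p + c ord0.
  rewrite Em addnC big_distrl; congr addn; apply: eq_bigr => j _.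
  by rewrite lift0 expnSr mulnA.
move=> j; have [j' ->|->] := unliftP ord0 j; last first.
  by rewrite /digit expn0 divn1 Em modnMDl modn_small.
have := IH (m %/ p) (fun i => c (lift ord0 i)) (fun i => lt _).
rewrite {1}Em divnMDl // divn_small // addn0 => /(_ erefl j') <-.
by rewrite /digit lift0 expnS divnMA.
Qed.

(** Digit vectors bounded by the digits of [n] correspond to the members of [P] together with [n]
    itself, which accounts for the successor. *)
Lemma card_Pset (p n : nat) : prime p -> 0 < n ->
  #|Pset p n|.+1 = \prod_(j < (topk p n).+1) (digit p n j).+1.
Proof.
move=> pr n_gt0; have p_gt1 := prime_gt1 pr; have p_gt0 := prime_gt0 pr.
have n_ltn := trunc_log_ltn n p_gt1; rewrite -/(topk p n) in n_ltn.
set K := (topk p n).+1 in n_ltn *.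
pose F (j : 'I_K) : pred 'I_p := [pred x : 'I_p | x <= digit p n j].
pose value (f : {ffun 'I_K -> 'I_p}) := \sum_(j < K) f j * p ^ j.
have digitE (f : {ffun 'I_K -> 'I_p}) (j : 'I_K) : digit p (value f) j = f j.
  by rewrite (digit_eq (c := fun i => f i) _ (erefl (value f))) // => i; apply: ltn_ord.
have value_inj : injective value.
  by move=> f g E; apply/ffunP => j; apply: val_inj; rewrite /= -!digitE E.
have value_leq f : f \in family F -> value f <= n.
  move=> /familyP Ff; rewrite [leqRHS](sum_digits n_ltn); apply: leq_sum => j _.
  by rewrite leq_mul2r; apply/orP; right; apply: Ff.
have card_F : #|family F| = \prod_(j < K) (digit p n j).+1.
  rewrite card_family foldrE big_map big_enum /=; apply: eq_bigr => j _.
  have lt : (digit p n j).+1 <= p by apply: ltn_pmod.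
  by rewrite -[RHS](card_ord_lt lt) cardsE; apply: eq_card.
(* Values may equal [n], so they are taken in ['I_n.+1], where [ord_max] is the excluded [n]. *)
pose g f : 'I_n.+1 := inord (value f).
have g_inj : {in family F &, injective g}.
  move=> f f' Ff Ff' /(congr1 val) /=; rewrite !inordK ?ltnS ?value_leq //.
  exact: value_inj.
have widen_inj : injective (widen_ord (leqnSn n)) by move=> x y /(congr1 val)/= /val_inj.
rewrite -card_F -(card_in_imset g_inj) -(card_imset _ widen_inj).
set W := _ @: _.
have nW : ord_max \notin W.
  apply/imsetP => -[x _ /(congr1 val) /= E].
  by have := ltn_ord x; rewrite -E ltnn.
transitivity #|ord_max |: W|; first by rewrite cardsU1 nW.
apply: eq_card => m; rewrite in_setU1.
apply/orP/imsetP => [[/eqP ->|/imsetP[x + ->]]|[f Ff ->]].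
- have lt (j : 'I_K) : digit p n j < p by apply: ltn_pmod.
  exists [ffun j => Ordinal (lt j)].
    by apply/familyP => j; rewrite ffunE inE /=.
  apply: val_inj; rewrite /= inordK /value.
    by rewrite [LHS](sum_digits n_ltn); apply: eq_bigr => j _; rewrite ffunE.
  by rewrite ltnS [leqRHS](sum_digits n_ltn); apply/eq_leq/eq_bigr => j _; rewrite ffunE.
- rewrite inE => /existsP[f /andP[/forallP le /eqP Ex]]; exists f; first exact/familyP.
  have Ev : value f = x by rewrite Ex.
  have lt : value f < n.+1 by rewrite Ev ltnS ltnW.
  by apply: val_inj; rewrite /= (inordK lt) Ev.
have := value_leq f Ff; rewrite leq_eqVlt => /orP[/eqP E|lt]; [left|right].
  by apply/eqP/val_inj; rewrite /= inordK E.
apply/imsetP; exists (Ordinal lt); last by apply: val_inj; rewrite /= inordK // ltnW.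
rewrite inE; apply/existsP; exists f; rewrite /= eqxx andbT.
by apply/forallP => j; move/familyP: Ff; apply.
Qed.

Lemma Pset_digit (p n : nat) (m : 'I_n) (j : 'I_(topk p n).+1) :
  m \in Pset p n -> digit p m j <= digit p n j.
Proof.
rewrite inE => /existsP[f /andP[/forallP le /eqP Em]].
have := digit_eq (fun i => ltn_ord (f i)) Em j => ->; exact: le.
Qed.

Lemma Pset_full (p n : nat) : prime p -> 0 < n ->
  [forall j : 'I_(topk p n), digit p n j == p.-1] = (Pset p n == setT).
Proof.
move=> pr n_gt0; have p_gt1 := prime_gt1 pr; have p_gt0 := prime_gt0 pr.
apply/forallP/eqP => [full|full j].
  apply/setP => m; rewrite !inE.
  have n_ltn := trunc_log_ltn n p_gt1; rewrite -/(topk p n) in n_ltn.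
  have m_ltn := ltn_trans (ltn_ord m) n_ltn.
  have lt (j : 'I_(topk p n).+1) : digit p m j < p by apply: ltn_pmod.
  apply/existsP; exists [ffun j => Ordinal (lt j)]; apply/andP; split; last first.
    by apply/eqP; rewrite [LHS](sum_digits m_ltn); apply: eq_bigr => j _; rewrite ffunE.
  apply/forallP => j; rewrite ffunE /=; have [lt_j|ge_j] := ltnP j (topk p n).
    have /eqP /= -> := full (Ordinal lt_j); rewrite -ltnS prednK //; exact: lt.
  (* At the top position the digit is the quotient by [p ^ k], which is monotone. *)
  have -> : val j = topk p n by apply/eqP; rewrite eqn_leq ge_j -ltnS ltn_ord.
  rewrite /digit !modn_small ?leq_div2r ?(ltnW (ltn_ord m)) //;
    by rewrite ltn_divLR ?expn_gt0 ?p_gt0 // -expnS.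
(* Conversely [p.-1 * p ^ j] with [j < k] is below [n], so it lies in [P] and its digit [p.-1]
   bounds that of [n] from below. *)
have lt : p.-1 * p ^ j < n.
  apply: leq_trans (trunc_logP p_gt1 n_gt0); apply: leq_trans (_ : p ^ j.+1 <= _); last first.
    by rewrite leq_exp2l // ltn_ord.
  by rewrite expnS ltn_pmul2r ?expn_gt0 ?p_gt0 // prednK.
have lt_j : j < (topk p n).+1 by apply: ltnW; rewrite ltnS ltn_ord.
have : Ordinal lt \in Pset p n by rewrite full inE.
move=> /(@Pset_digit _ _ _ (Ordinal lt_j)) /=.
rewrite {1}/digit mulnK ?expn_gt0 ?p_gt0 // modn_small ?prednK // => le.
by rewrite eqn_leq le -ltnS prednK // ltn_pmod.
Qed.

(** * Sign reversal and the final count *)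

Lemma card_ribbon_opp (p n : nat) (c : 'F_p) : prime p -> 0 < n -> Pset p n != setT ->
  #|[set S : {set 'I_n} | (ribbon S)%:R == c]%R| =
  #|[set S : {set 'I_n} | (ribbon S)%:R == - c]%R|.
Proof.
move=> pr n_gt0 nfull.
have [x xP] : exists x, x \notin Pset p n.
  apply/existsP; apply: contraNT nfull; rewrite negb_exists => /forallP H.
  by apply/eqP/setP => x; rewrite in_setT; apply: negbNE (H x).
(* Toggling [x] keeps [S :&: P] and changes the size of [S :\: P] by 1, so this involution negates
   the ribbon number modulo [p]. *)
pose tog (S : {set 'I_n}) := if x \in S then S :\ x else x |: S.
have togK : involutive tog.
  move=> S; rewrite /tog; have [xS|xS] := boolP (x \in S); first by rewrite setD11 setD1K.
  by rewrite setU11 setU1K.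
have tog_opp S : ((ribbon (tog S))%:R = - (ribbon S)%:R :> 'F_p)%R.
  wlog xS : S / x \in S.
    move=> H; have [/H//|xS] := boolP (x \in S).
    apply/eqP; rewrite -eqr_oppLR -H ?togK //.
    by rewrite /tog (negbTE xS) setU11.
  rewrite /tog xS ribbon_Pset // [in RHS]ribbon_Pset //.
  have -> : (S :\ x) :&: Pset p n = S :&: Pset p n.
    apply/setP => y; rewrite !(in_setI, in_setD1); case: eqVneq => // ->.
    by rewrite (negbTE xP) !andbF.
  have -> : S :\ x :\: Pset p n = (S :\: Pset p n) :\ x by rewrite setDDl setUC -setDDl.
  by rewrite [in RHS](cardsD1 x (S :\: _)) in_setD xS xP /= exprS mulN1r mulNr opprK.
rewrite -(card_imset _ (inv_inj togK)); apply: eq_card => S; rewrite inE.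
apply/imsetP/idP => [[S']|E]; first by rewrite inE => /eqP <- ->; rewrite tog_opp.
by exists (tog S); rewrite ?togK // inE tog_opp eqr_oppLR.
Qed.

Theorem theorem4p3 (p n i : nat) :
  prime p -> odd p -> 2 <= n -> i < p ->
  let k := topk p n in
  let N := \prod_(j < k.+1) (digit p n j).+1 in
  cB p i n =
  if (i == 0) || [forall j : 'I_k, digit p n j == p.-1] then
    2 ^ (n.+1 - N) *
      #|[set T : {set 'I_n} | (T \subset Pset p n) &&
                              (rB p T == Posz i %[mod Posz p])%Z]|
  else
    2 ^ (n - N) *
      #|[set T : {set 'I_n} | (T \subset Pset p n) &&
           ((rB p T == Posz i %[mod Posz p])%Z ||
            (rB p T == (- Posz i)%R %[mod Posz p])%Z)]|.
Proof.
move=> pr p_odd n_ge2 lt_ip k N; have n_gt0 : 0 < n by apply: ltnW.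
(* The exponent of 2 counts the points outside [P]. *)
have card_cP : #|~: Pset p n| = n.+1 - N.
  by rewrite /N /k -card_Pset // subSS cardsCs setCK card_ord.
have iE : (Posz i)%:~R%R = (i%:R : 'F_p)%R by rewrite pmulrn.
have rBE (T : {set 'I_n}) (z : int) :
    (rB p T == z %[mod Posz p])%Z = ((ribbon T)%:R == z%:~R :> 'F_p)%R.
  by rewrite eqz_mod_Fp // rB_ribbon.
have -> : cB p i n = #|[set S : {set 'I_n} | (ribbon S)%:R == i%:R :> 'F_p]%R|.
  by rewrite cB_ribbon; apply: eq_card => S; rewrite !inE -eqn_mod_Fp // (modn_small lt_ip).
rewrite (Pset_full pr n_gt0); case: ifP => [|/norP[i_neq0 nfull]].
  move=> H; rewrite -card_cP.
  under [in RHS]eq_finset do rewrite rBE iE.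
  rewrite -(card_setI_preim _ (fun T : {set 'I_n} => (ribbon T)%:R == i%:R :> 'F_p)%R).
  (* For residue 0 the sign is irrelevant; for full [P] the intersection is [S]. *)
  apply: eq_card => S; rewrite !inE; case/orP: H => [/eqP ->|/eqP ->]; last by rewrite setIT.
  by rewrite ribbon_Pset // mulf_eq0 signr_eq0.
under [in RHS]eq_finset do rewrite !rBE rmorphN iE.
(* As [p] is odd and [0 < i < p], the fibres over [i] and [- i] are disjoint. *)
have i_neq_opp : (i%:R != - i%:R :> 'F_p)%R.
  rewrite -subr_eq0 opprK -natrD -[0%R]/(0%:R)%R -eqn_mod_Fp // mod0n.
  rewrite addnn -muln2 -/(dvdn _ _) Euclid_dvdM // negb_or; apply/andP; split.
    by rewrite gtnNdvd // lt0n.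
  by rewrite gtnNdvd //; move: (prime_gt1 pr) p_odd; case: (p) => [|[|[|]]].
have cP_gt0 : 0 < #|~: Pset p n|.
  rewrite lt0n cards_eq0; apply: contraNneq nfull => E.
  by rewrite -[Pset p n]setCK E setC0.
(* Twice the count for [i] is the count for [i] or [- i], a condition that depends only on
   [S :&: P]. *)
apply/eqP; rewrite -(eqn_pmul2l (ltn0Sn 1)) mulnA -expnS.
(* A point outside [P] ensures [N <= n], so [n - N] is not truncated. *)
have -> : (n - N).+1 = #|~: Pset p n| by move: cP_gt0; rewrite card_cP; lia.
rewrite -(card_setI_preim _ (fun T : {set 'I_n} =>
  ((ribbon T)%:R == i%:R :> 'F_p) || ((ribbon T)%:R == - i%:R :> 'F_p))%R).
rewrite mul2n -addnn {2}card_ribbon_opp // -cardsUI [X in _ + X]eq_card0 ?addn0; last first.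
  move=> S; rewrite !inE; apply/negP => /andP[/eqP -> E].
  by rewrite E in i_neq_opp.
apply/eqP/eq_card => S; rewrite !inE [in LHS]ribbon_Pset // -signr_odd.
case: (odd _); rewrite ?expr0 ?mul1r // expr1 mulN1r eqr_oppLR eqr_opp.
by rewrite orbC.
Qed.
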